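(* Let $(\mathcal{C},\otimes,1)$ be an abelian monoidal category with right exact tensor product such that $1$ is a left $\otimes$-generator in $\mathcal{C}$, and let $f:R\to S$ be an algebra morphism in $\mathcal{C}$ such that $f^*=-\otimes_R S:\mathcal{C}_R\to\mathcal{C}_S$ is semiseparable. Consider the image factorization $f=\varphi\circ\psi$ in $\mathcal{C}$, with $\psi:R\to\mathrm{Im}(f)$ an epimorphism and $\varphi:\mathrm{Im}(f)\to S$ a monomorphism. Then $\psi^*=-\otimes_R\mathrm{Im}(f):\mathcal{C}_R\to\mathcal{C}_{\mathrm{Im}(f)}$ is naturally full and $\varphi^*=-\otimes_{\mathrm{Im}(f)}S:\mathcal{C}_{\mathrm{Im}(f)}\to\mathcal{C}_S$ is separable.
   Context: Associativity and unit constraints are suppressed. An abelian monoidal category is a monoidal category which is abelian and whose tensor functors $X\otimes-$ and $-\otimes X$ are additive; the tensor product is right exact if all these functors are right exact. For an algebra $A$ in $\mathcal{C}$, $m_A$ and $u_A:1\to A$ are its multiplication and unit, and $\mathcal{C}_A$ (resp. ${}_A\mathcal{C}$) is the category of right (resp. left) $A$-modules in $\mathcal{C}$. The object $\mathrm{Im}(f)$ is regarded as an algebra in $\mathcal{C}$ with unit $\psi\circ u_R$ and with the unique multiplication $m_{\mathrm{Im}(f)}$ such that $\varphi\circ m_{\mathrm{Im}(f)}=m_S\circ(\varphi\otimes\varphi)$; with this structure, $\psi$ and $\varphi$ are algebra morphisms. For $M\in\mathcal{C}_A$ with action $\nu:M\otimes A\to M$ and $X\in{}_A\mathcal{C}$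 with action $\mu:A\otimes X\to X$, $q^A_{M,X}:M\otimes X\to M\otimes_A X$ denotes the coequalizer of $\nu\otimes\mathrm{Id}_X$ and $\mathrm{Id}_M\otimes\mu$. For an algebra morphism $\theta:A\to B$, $B$ is a left $A$-module via $m_B(\theta\otimes\mathrm{Id}_B)$, and the induction functor $\theta^*=-\otimes_A B:\mathcal{C}_A\to\mathcal{C}_B$ sends $X$ to $X\otimes_A B$ with right $B$-action induced by $m_B$, and a morphism $h:X\to Y$ to the unique morphism $h\otimes_A B$ with $(h\otimes_A B)q^A_{X,B}=q^A_{Y,B}(h\otimes\mathrm{Id}_B)$. An object $P$ is a left $\otimes$-generator of $\mathcal{C}$ if for any morphisms $f,g:Y\otimes Z\to W$ in $\mathcal{C}$ with $f(\varepsilon\otimes\mathrm{Id}_Z)=g(\varepsilon\otimes\mathrm{Id}_Z)$ for all $\varepsilon:P\to Y$ in $\mathcal{C}$, one has $f=g$. A functor $F:\mathcal{A}\to\mathcal{B}$ induces the natural transformation $\mathcal{F}:\mathrm{Hom}_{\mathcal{A}}(-,-)\to\mathrm{Hom}_{\mathcal{B}}(F-,F-)$, $f\mapsto F(f)$. $F$ is separable (resp. naturally full, semiseparable) if there is a natural transformation $\mathcal{P}:\mathrm{Hom}_{\mathcal{B}}(F-,F-)\to\mathrm{Hom}_{\mathcal{A}}(-,-)$ with $\mathcal{P}\circ\mathcal{F}=\mathrm{Id}$ (resp. $\mathcal{F}\circ\mathcal{P}=\mathrm{Id}$, $\mathcal{F}\circ\mathcal{P}\circ\mathcal{F}=\mathcal{F}$).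 *)

(* Defs.v *)
From HB Require Import structures.
From mathcomp Require Import all_boot all_algebra.
From mathcomp Require Import boolp.

Set Implicit Arguments.
Unset Strict Implicit.
Unset Printing Implicit Defensive.

#[local] Obligation Tactic := idtac.

Import GRing.Theory.
Local Open Scope ring_scope.

Declare Scope cat_scope.
Delimit Scope cat_scope with cat.
Open Scope cat_scope.

Record category := Category {
  obj :> Type;
  hom : obj -> obj -> Type;
  idm : forall X, hom X X;
  comp : forall X Y Z, hom Y Z -> hom X Y -> hom X Z;
  comp_idl : forall X Y (f : hom X Y), comp (idm Y) f = f;
  comp_idr : forall X Y (f : hom X Y), comp f (idm X) = f;
  compA : forall X Y Z W (h : hom Z W) (g : hom Y Z) (f : hom X Y),
    comp h (comp g f) = comp (comp h g) f }.

Arguments hom {_} X Y.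
Arguments idm {_} X.
Notation "g \oc f" := (comp g f) (at level 45, left associativity) : cat_scope.

Definition mono (C : category) (X Y : C) (f : hom X Y) :=
  forall (Z : C) (g h : hom Z X), f \oc g = f \oc h -> g = h.

Definition epi (C : category) (X Y : C) (f : hom X Y) :=
  forall (Z : C) (g h : hom Y Z), g \oc f = h \oc f -> g = h.

Definition iso (C : category) (X Y : C) (f : hom X Y) :=
  exists g : hom Y X, g \oc f = idm X /\ f \oc g = idm Y.

Definition is_coequalizer (C : category) (X Y Q : C) (f g : hom X Y)
    (q : hom Y Q) :=
  q \oc f = q \oc g /\
  forall (Z : C) (h : hom Y Z), h \oc f = h \oc g ->
    exists! u : hom Q Z, u \oc q = h.

Record functor (A B : category) := Functor {
  fobj :> A -> B;
  fmap : forall X Y, hom X Y -> hom (fobj X) (fobj Y);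
  fmap_id : forall X, fmap (idm X) = idm (fobj X);
  fmap_comp : forall X Y Z (g : hom Y Z) (f : hom X Y),
    fmap (g \oc f) = fmap g \oc fmap f }.

Arguments fmap {A B} F {X Y} _ : rename.

(* Naturality in both variables of a family
   Hom_B(F X, F Y) -> Hom_A(X, Y). *)
Definition natural_family (A B : category) (F : functor A B)
    (P : forall X Y : A, hom (F X) (F Y) -> hom X Y) :=
  forall (X X' Y Y' : A) (h : hom X' X) (k : hom Y Y') (g : hom (F X) (F Y)),
    P X' Y' (fmap F k \oc g \oc fmap F h) = k \oc P X Y g \oc h.

Definition separable (A B : category) (F : functor A B) :=
  exists P : forall X Y : A, hom (F X) (F Y) -> hom X Y,
    natural_family P /\
    forall (X Y : A) (h : hom X Y), P X Y (fmap F h) = h.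

Definition naturally_full (A B : category) (F : functor A B) :=
  exists P : forall X Y : A, hom (F X) (F Y) -> hom X Y,
    natural_family P /\
    forall (X Y : A) (g : hom (F X) (F Y)), fmap F (P X Y g) = g.

Definition semiseparable (A B : category) (F : functor A B) :=
  exists P : forall X Y : A, hom (F X) (F Y) -> hom X Y,
    natural_family P /\
    forall (X Y : A) (h : hom X Y), fmap F (P X Y (fmap F h)) = fmap F h.

Record zmod_category := ZmodCategory {
  zcat :> category;
  zclass : forall X Y : zcat, GRing.Zmodule (hom X Y) }.

Definition hom_zmod (C : zmod_category) (X Y : C) : zmodType :=
  GRing.Zmodule.Pack (zclass X Y).

HB.instance Definition _ (C : zmod_category) (X Y : C) :=
  GRing.Zmodule.copy (@hom C X Y) (hom_zmod X Y).

Definition is_preadditive (C : zmod_category) :=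
  (forall (X Y Z : C) (g g' : hom Y Z) (f : hom X Y),
     (g + g') \oc f = g \oc f + g' \oc f) /\
  (forall (X Y Z : C) (g : hom Y Z) (f f' : hom X Y),
     g \oc (f + f') = g \oc f + g \oc f').

Definition is_zero_object (C : category) (Z : C) :=
  forall X : C, (exists! f : hom X Z, True) /\ (exists! f : hom Z X, True).

Definition is_biproduct (C : zmod_category) (X Y B : C)
    (i1 : hom X B) (i2 : hom Y B) (p1 : hom B X) (p2 : hom B Y) :=
  [/\ p1 \oc i1 = idm X, p2 \oc i2 = idm Y, p1 \oc i2 = 0, p2 \oc i1 = 0
    & i1 \oc p1 + i2 \oc p2 = idm B].

Definition is_kernel (C : zmod_category) (X Y K : C) (f : hom X Y)
    (k : hom K X) :=
  f \oc k = 0 /\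
  forall (Z : C) (h : hom Z X), f \oc h = 0 -> exists! u : hom Z K, k \oc u = h.

Definition is_cokernel (C : zmod_category) (X Y Q : C) (f : hom X Y)
    (q : hom Y Q) :=
  q \oc f = 0 /\
  forall (Z : C) (h : hom Y Z), h \oc f = 0 -> exists! u : hom Q Z, u \oc q = h.

Record is_abelian (C : zmod_category) : Prop := IsAbelian {
  abelian_preadditive : is_preadditive C;
  abelian_zero : exists Z : C, is_zero_object Z;
  abelian_biproduct : forall X Y : C, exists (B : C)
    (i1 : hom X B) (i2 : hom Y B) (p1 : hom B X) (p2 : hom B Y),
    is_biproduct i1 i2 p1 p2;
  abelian_kernel : forall (X Y : C) (f : hom X Y),
    exists (K : C) (k : hom K X), is_kernel f k;
  abelian_cokernel : forall (X Y : C) (f : hom X Y),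
    exists (Q : C) (q : hom Y Q), is_cokernel f q;
  abelian_mono : forall (X Y : C) (f : hom X Y), mono f ->
    exists (Z : C) (g : hom Y Z), is_kernel g f;
  abelian_epi : forall (X Y : C) (f : hom X Y), epi f ->
    exists (Z : C) (g : hom Z X), is_cokernel g f }.

Definition additive_functor (C D : zmod_category) (F : functor C D) :=
  forall (X Y : C) (f g : hom X Y), fmap F (f + g) = fmap F f + fmap F g.

(* For an additive functor between abelian categories: every exact sequence
   X -> Y -> Z -> 0, i.e. every cokernel, is sent to an exact sequence. *)
Definition right_exact (C D : zmod_category) (F : functor C D) :=
  forall (X Y Z : C) (f : hom X Y) (g : hom Y Z),
    is_cokernel f g -> is_cokernel (fmap F f) (fmap F g).

Record monoidal (C : category) := Monoidal {
  tensor : C -> C -> C;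
  tensorm : forall X X' Y Y' : C,
    hom X X' -> hom Y Y' -> hom (tensor X Y) (tensor X' Y');
  tensorm_id : forall X Y : C,
    tensorm (idm X) (idm Y) = idm (tensor X Y);
  tensorm_comp : forall (X X' X'' Y Y' Y'' : C) (f' : hom X' X'') (f : hom X X')
    (g' : hom Y' Y'') (g : hom Y Y'),
    tensorm (f' \oc f) (g' \oc g) = tensorm f' g' \oc tensorm f g;
  munit : C;
  assoc : forall X Y Z : C,
    hom (tensor (tensor X Y) Z) (tensor X (tensor Y Z));
  lunit : forall X : C, hom (tensor munit X) X;
  runit : forall X : C, hom (tensor X munit) X;
  assoc_iso : forall X Y Z, iso (assoc X Y Z);
  lunit_iso : forall X, iso (lunit X);
  runit_iso : forall X, iso (runit X);
  assoc_nat : forall (X X' Y Y' Z Z' : C)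
    (f : hom X X') (g : hom Y Y') (h : hom Z Z'),
    assoc X' Y' Z' \oc tensorm (tensorm f g) h =
    tensorm f (tensorm g h) \oc assoc X Y Z;
  lunit_nat : forall (X Y : C) (f : hom X Y),
    lunit Y \oc tensorm (idm munit) f = f \oc lunit X;
  runit_nat : forall (X Y : C) (f : hom X Y),
    runit Y \oc tensorm f (idm munit) = f \oc runit X;
  pentagon : forall X Y Z W : C,
    assoc X Y (tensor Z W) \oc assoc (tensor X Y) Z W =
    tensorm (idm X) (assoc Y Z W) \oc assoc X (tensor Y Z) W
      \oc tensorm (assoc X Y Z) (idm W);
  triangle : forall X Y : C,
    tensorm (idm X) (lunit Y) \oc assoc X munit Y =
    tensorm (runit X) (idm Y) }.

Section TensorFunctors.
Variables (C : category) (M : monoidal C) (X : C).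

Program Definition tensorl : functor C C :=
  {| fobj := fun Y => tensor M X Y;
     fmap := fun Y Y' f => tensorm M (idm X) f |}.
Next Obligation. by move=> Y; rewrite /= tensorm_id. Qed.
Next Obligation.
by move=> Y Y' Y'' g f; rewrite /= -tensorm_comp comp_idl.
Qed.

Program Definition tensorr : functor C C :=
  {| fobj := fun Y => tensor M Y X;
     fmap := fun Y Y' f => tensorm M f (idm X) |}.
Next Obligation. by move=> Y; rewrite /= tensorm_id. Qed.
Next Obligation.
by move=> Y Y' Y'' g f; rewrite /= -tensorm_comp comp_idl.
Qed.

End TensorFunctors.

Record abelian_monoidal := AbelianMonoidal {
  am_cat :> zmod_category;
  am_abelian : is_abelian am_cat;
  am_mon : monoidal am_cat;
  am_additivel : forall X : am_cat, additive_functor (tensorl am_mon X);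
  am_additiver : forall X : am_cat, additive_functor (tensorr am_mon X) }.

Notation "X \ox Y" := (tensor (am_mon _) X Y)
  (at level 40, left associativity) : cat_scope.
Notation "f \om g" := (tensorm (am_mon _) f g)
  (at level 40, left associativity) : cat_scope.
Notation "\one" := (munit (am_mon _)) : cat_scope.
Notation assc := (assoc (am_mon _)).
Notation lunt := (lunit (am_mon _)).
Notation runt := (runit (am_mon _)).

Definition right_exact_tensor (C : abelian_monoidal) :=
  forall X : C, right_exact (tensorl (am_mon C) X) /\
                right_exact (tensorr (am_mon C) X).

Definition left_tensor_generator (C : abelian_monoidal) (P : C) :=
  forall (Y Z W : C) (f g : hom (Y \ox Z) W),
    (forall e : hom P Y, f \oc (e \om idm Z) = g \oc (e \om idm Z)) -> f = g.

Record algebra (C : abelian_monoidal) := Algebra {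
  alg_obj :> C;
  alg_mul : hom (alg_obj \ox alg_obj) alg_obj;
  alg_unit : hom \one alg_obj;
  alg_mulA : alg_mul \oc (alg_mul \om idm alg_obj) =
    alg_mul \oc (idm alg_obj \om alg_mul) \oc assc _ _ _;
  alg_mul1l : alg_mul \oc (alg_unit \om idm alg_obj) = lunt alg_obj;
  alg_mul1r : alg_mul \oc (idm alg_obj \om alg_unit) = runt alg_obj }.

Record alg_hom (C : abelian_monoidal) (A B : algebra C) := AlgHom {
  alg_homm :> hom A B;
  alg_hom_mul : alg_homm \oc alg_mul A = alg_mul B \oc (alg_homm \om alg_homm);
  alg_hom_unit : alg_homm \oc alg_unit A = alg_unit B }.

Record rmodule (C : abelian_monoidal) (A : algebra C) := RModule {
  rmod_obj :> C;
  ract : hom (rmod_obj \ox A) rmod_obj;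
  ractA : ract \oc (ract \om idm A) =
    ract \oc (idm rmod_obj \om alg_mul A) \oc assc _ _ _;
  ract1 : ract \oc (idm rmod_obj \om alg_unit A) = runt rmod_obj }.

Record lmodule (C : abelian_monoidal) (A : algebra C) := LModule {
  lmod_obj :> C;
  lact : hom (A \ox lmod_obj) lmod_obj;
  lactA : lact \oc (alg_mul A \om idm lmod_obj) =
    lact \oc (idm A \om lact) \oc assc _ _ _;
  lact1 : lact \oc (alg_unit A \om idm lmod_obj) = lunt lmod_obj }.

Record rmod_hom (C : abelian_monoidal) (A : algebra C) (M N : rmodule A) :=
  RModHom {
  rmod_homm :> hom M N;
  rmod_hom_act : rmod_homm \oc ract M = ract N \oc (rmod_homm \om idm A) }.

Lemma rmod_hom_inj (C : abelian_monoidal) (A : algebra C) (M N : rmodule A)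
    (f g : rmod_hom M N) : rmod_homm f = rmod_homm g -> f = g.
Proof.
case: f g => [f hf] [g hg] /= e; case: _ / e in hg *.
by rewrite (eq_irrelevance hf hg).
Qed.

Section TensorLemmas.
Variable C : abelian_monoidal.

Lemma tens_comp (X X' X'' Y Y' Y'' : C) (f' : hom X' X'') (f : hom X X')
  (g' : hom Y' Y'') (g : hom Y Y') :
  (f' \om g') \oc (f \om g) = (f' \oc f) \om (g' \oc g).
Proof. by rewrite tensorm_comp. Qed.

End TensorLemmas.

Section ModuleCategory.
Variables (C : abelian_monoidal) (A : algebra C).

Program Definition rmod_id (M : rmodule A) : rmod_hom M M :=
  {| rmod_homm := idm M |}.
Next Obligation. by move=> M; rewrite tensorm_id comp_idl comp_idr. Qed.

Program Definition rmod_comp (M N P : rmodule A)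
  (g : rmod_hom N P) (f : rmod_hom M N) : rmod_hom M P :=
  {| rmod_homm := rmod_homm g \oc rmod_homm f |}.
Next Obligation.
move=> M N P g f.
by rewrite -compA rmod_hom_act compA rmod_hom_act -compA tens_comp comp_idl.
Qed.

Program Definition rmod_cat : category :=
  {| obj := rmodule A; hom := @rmod_hom C A; idm := rmod_id;
     comp := rmod_comp |}.
Next Obligation. by move=> M N f; apply: rmod_hom_inj; apply: comp_idl. Qed.
Next Obligation. by move=> M N f; apply: rmod_hom_inj; apply: comp_idr. Qed.
Next Obligation.
by move=> M N P Q h g f; apply: rmod_hom_inj; apply: compA.
Qed.

End ModuleCategory.

Section Coequalizers.
Variable C : abelian_monoidal.

Lemma comp_addl (X Y Z : C) (g g' : hom Y Z) (f : hom X Y) :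
  (g + g') \oc f = g \oc f + g' \oc f.
Proof. exact: (abelian_preadditive (am_abelian C)).1. Qed.

Lemma comp_addr (X Y Z : C) (g : hom Y Z) (f f' : hom X Y) :
  g \oc (f + f') = g \oc f + g \oc f'.
Proof. exact: (abelian_preadditive (am_abelian C)).2. Qed.

Lemma comp_0r (X Y Z : C) (g : hom Y Z) : g \oc (0 : hom X Y) = 0.
Proof. by apply: (@addrI _ (g \oc 0)); rewrite -comp_addr !addr0. Qed.

Lemma comp_0l (X Y Z : C) (f : hom X Y) : (0 : hom Y Z) \oc f = 0.
Proof. by apply: (@addrI _ (0 \oc f)); rewrite -comp_addl !addr0. Qed.

Lemma comp_subr (X Y Z : C) (g : hom Y Z) (f f' : hom X Y) :
  g \oc (f - f') = g \oc f - g \oc f'.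
Proof.
by apply: (@addIr _ (g \oc f')); rewrite -comp_addr !subrK.
Qed.

Lemma comp_sub_eq0 (X Y Z : C) (g : hom Y Z) (f f' : hom X Y) :
  g \oc (f - f') = 0 <-> g \oc f = g \oc f'.
Proof.
rewrite comp_subr; split; first exact: subr0_eq.
by move=> ->; rewrite subrr.
Qed.

Lemma coequalizer_cokernel (X Y Q : C) (f g : hom X Y) (q : hom Y Q) :
  is_coequalizer f g q <-> is_cokernel (f - g) q.
Proof.
split=> -[h u]; split; try exact/comp_sub_eq0.
- by move=> Z k /comp_sub_eq0; apply: u.
- by move=> Z k /comp_sub_eq0; apply: u.
Qed.

Lemma coequalizer_ex (X Y : C) (f g : hom X Y) :
  exists q : {Q : C & hom Y Q}, is_coequalizer f g (projT2 q).
Proof.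
have [Q [q hq]] := abelian_cokernel (am_abelian C) (f - g).
by exists (existT _ Q q); apply/coequalizer_cokernel.
Qed.

Lemma coequalizer_epi (X Y Q : C) (f g : hom X Y) (q : hom Y Q) :
  is_coequalizer f g q -> epi q.
Proof.
case=> e u Z h k hk; have [|w [_ uw]] := u Z (k \oc q).
  by rewrite -!compA e.
by rewrite -(uw h hk) -(uw k erefl).
Qed.

(* Coequalizers are unique only up to isomorphism; one is fixed for each
   parallel pair by choice. *)
Definition coeq (X Y : C) (f g : hom X Y) : C :=
  projT1 (projT1 (cid (coequalizer_ex f g))).

Definition coeq_map (X Y : C) (f g : hom X Y) : hom Y (coeq f g) :=
  projT2 (projT1 (cid (coequalizer_ex f g))).

Lemma coeq_mapP (X Y : C) (f g : hom X Y) : is_coequalizer f g (coeq_map f g).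
Proof. exact: (projT2 (cid (coequalizer_ex f g))). Qed.

Lemma coequalizer_factor (X Y Q Z : C) (f g : hom X Y) (q : hom Y Q)
  (hq : is_coequalizer f g q) (h : hom Y Z) (hh : h \oc f = h \oc g) :
  exists u : hom Q Z, u \oc q = h.
Proof. by have [u [hu _]] := hq.2 Z h hh; exists u. Qed.

Definition coeq_lift (X Y Q Z : C) (f g : hom X Y) (q : hom Y Q)
    (hq : is_coequalizer f g q) (h : hom Y Z) (hh : h \oc f = h \oc g) :
    hom Q Z :=
  projT1 (cid (coequalizer_factor hq hh)).

Lemma coeq_liftE (X Y Q Z : C) (f g : hom X Y) (q : hom Y Q)
  (hq : is_coequalizer f g q) (h : hom Y Z) (hh : h \oc f = h \oc g) :
  coeq_lift hq hh \oc q = h.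
Proof. exact: (projT2 (cid (coequalizer_factor hq hh))). Qed.

Lemma right_exact_coequalizer (F : functor C C) (addF : additive_functor F)
  (exF : right_exact F) (X Y Q : C) (f g : hom X Y) (q : hom Y Q) :
  is_coequalizer f g q -> is_coequalizer (fmap F f) (fmap F g) (fmap F q).
Proof.
move=> /coequalizer_cokernel/exF hq; apply/coequalizer_cokernel.
suff -> : fmap F f - fmap F g = fmap F (f - g) by [].
by apply: (@addIr _ (fmap F g)); rewrite -addF !subrK.
Qed.

Lemma right_exact_epi (F : functor C C) (exF : right_exact F) (X Y : C)
  (f : hom X Y) : epi f -> epi (fmap F f).
Proof.
move=> /(abelian_epi (am_abelian C)) [Z [g /exF [h u]]] W k l e.
have [|w [_ uw]] := u W (l \oc fmap F f).
  by rewrite -compA h comp_0r.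
by rewrite -(uw k e) -(uw l erefl).
Qed.

End Coequalizers.

Section TensorOver.
Variables (C : abelian_monoidal) (A : algebra C).
Variables (M : rmodule A) (X : lmodule A).

Definition tensor_over_l : hom ((M \ox A) \ox X) (M \ox X) :=
  ract M \om idm X.

Definition tensor_over_r : hom ((M \ox A) \ox X) (M \ox X) :=
  (idm M \om lact X) \oc assc M A X.

Definition tensor_over : C := coeq tensor_over_l tensor_over_r.

Definition tensor_over_q : hom (M \ox X) tensor_over :=
  coeq_map tensor_over_l tensor_over_r.

Lemma tensor_over_qP :
  is_coequalizer tensor_over_l tensor_over_r tensor_over_q.
Proof. exact: coeq_mapP. Qed.

End TensorOver.

Section Restriction.
Variables (C : abelian_monoidal) (A B : algebra C) (theta : alg_hom A B).

Program Definition alg_lmod : lmodule A :=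
  {| lmod_obj := alg_obj B; lact := alg_mul B \oc (theta \om idm B) |}.
Next Obligation.
rewrite -!compA tens_comp alg_hom_mul comp_idl.
rewrite -[in LHS](comp_idl (idm B)) -tens_comp !compA alg_mulA.
rewrite -!compA assoc_nat; congr (_ \oc _).
by rewrite !compA !tens_comp !comp_idr !comp_idl.
Qed.
Next Obligation.
by rewrite -compA tens_comp alg_hom_unit comp_idl alg_mul1l.
Qed.

End Restriction.

Section Kelly.
Variable C : abelian_monoidal.

Lemma iso_mono (X Y : C) (f : hom X Y) : iso f -> mono f.
Proof.
case=> g [gf _] Z h k e.
by rewrite -(comp_idl h) -(comp_idl k) -gf -!compA e.
Qed.

Lemma iso_epi (X Y : C) (f : hom X Y) : iso f -> epi f.
Proof.
case=> g [_ fg] Z h k e.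
by rewrite -(comp_idr h) -(comp_idr k) -fg !compA e.
Qed.

Lemma tens_compl (X Y Z W : C) (g : hom Y Z) (f : hom X Y) :
  (g \oc f) \om idm W = (g \om idm W) \oc (f \om idm W).
Proof. by rewrite tens_comp comp_idl. Qed.

Lemma tens_compr (X Y Z W : C) (g : hom Y Z) (f : hom X Y) :
  idm W \om (g \oc f) = (idm W \om g) \oc (idm W \om f).
Proof. by rewrite tens_comp comp_idl. Qed.

Lemma runit_tensor (X Y : C) :
  (idm X \om runt Y) \oc assc X Y \one = runt (X \ox Y).
Proof.
suff e : ((idm X \om runt Y) \oc assc X Y \one) \om idm \one =
         runt (X \ox Y) \om idm \one.
  apply: (iso_epi (runit_iso (am_mon C) _)).
  by rewrite -!runit_nat e.
apply: (iso_mono (assoc_iso (am_mon C) _ _ _)).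
rewrite tens_compl compA assoc_nat -triangle tens_compr -[in LHS]compA.
rewrite -triangle -!compA.
rewrite [in LHS]compA.
rewrite [in RHS]compA -(tensorm_id (am_mon C) X Y) assoc_nat -!compA.
rewrite [in RHS]pentagon !compA.
by [].
Qed.

End Kelly.

Section Induction.
Variables (C : abelian_monoidal) (hre : right_exact_tensor C).
Variables (A B : algebra C) (theta : alg_hom A B).

Let BA := alg_lmod theta.
Let T (M : rmodule A) : C := tensor_over M BA.
Let q (M : rmodule A) : hom (M \ox B) (T M) := tensor_over_q M BA.

Lemma ind_q_epi (M : rmodule A) : epi (q M).
Proof. exact: coequalizer_epi (tensor_over_qP _ _). Qed.

Lemma ind_qBP (M : rmodule A) :
  is_coequalizer (tensor_over_l M BA \om idm B) (tensor_over_r M BA \om idm B)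
    (q M \om idm B).
Proof.
apply: (right_exact_coequalizer (F := tensorr (am_mon C) B)).
- exact: am_additiver.
- exact: (hre B).2.
- exact: tensor_over_qP.
Qed.

Lemma lact_mul : lact BA \oc (idm A \om alg_mul B) \oc assc A B B =
  alg_mul B \oc (lact BA \om idm B).
Proof.
rewrite /= tens_compl compA alg_mulA.
rewrite -!compA assoc_nat; congr (_ \oc _).
by rewrite !compA !tens_comp tensorm_id !comp_idl !comp_idr.
Qed.

Lemma ind_act_balanced (M : rmodule A) :
  let k := q M \oc (idm M \om alg_mul B) \oc assc M B B in
  k \oc (tensor_over_l M BA \om idm B) = k \oc (tensor_over_r M BA \om idm B).
Proof.
have e := (tensor_over_qP M BA).1; rewrite -/(q M) in e.
rewrite /= /tensor_over_l.
transitivity (q M \oc tensor_over_r M BA \oc (idm _ \om alg_mul B)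
  \oc assc (M \ox A) B B).
  rewrite -e -!compA assoc_nat; congr (_ \oc _).
  by rewrite /tensor_over_l !compA tensorm_id !tens_comp !comp_idl !comp_idr.
rewrite /tensor_over_r -!compA; congr (_ \oc _).
rewrite tens_compl.
rewrite [in RHS](compA (assc _ _ _)) assoc_nat.
rewrite !compA -tens_compr -lact_mul !tens_compr -!compA; congr (_ \oc _).
rewrite (compA (assc M A B)) -(tensorm_id (am_mon C) M A) assoc_nat.
rewrite -!compA; congr (_ \oc _).
by rewrite pentagon !compA.
Qed.

Definition ind_act (M : rmodule A) : hom (T M \ox B) (T M) :=
  coeq_lift (ind_qBP M) (ind_act_balanced M).

Lemma ind_actE (M : rmodule A) :
  ind_act M \oc (q M \om idm B) = q M \oc (idm M \om alg_mul B) \oc assc M B B.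
Proof. exact: coeq_liftE. Qed.

Program Definition ind_obj (M : rmodule A) : rmodule B :=
  {| rmod_obj := T M; ract := ind_act M |}.
Next Obligation.
move=> M.
have ep : epi ((q M \om idm B) \om idm B).
  apply: (right_exact_epi (F := tensorr (am_mon C) B)); first exact: (hre B).2.
  exact: coequalizer_epi (ind_qBP M).
apply: ep; rewrite /= -!compA assoc_nat -tens_compl ind_actE.
rewrite tensorm_id (compA (idm _ \om _)) tens_comp comp_idl comp_idr.
have -> : q M \om alg_mul B = (q M \om idm B) \oc (idm (M \ox B) \om alg_mul B).
  by rewrite tens_comp comp_idl comp_idr.
rewrite !tens_compl !compA ind_actE.
rewrite -!compA; congr (_ \oc _).
rewrite [in RHS](compA (assc M B B)) -(tensorm_id (am_mon C) M B) assoc_nat.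
rewrite -[in RHS]compA pentagon.
rewrite (compA (assc M B B)) assoc_nat.
by rewrite !compA -!tens_compr alg_mulA !tens_compr -!compA.
Qed.
Next Obligation.
move=> M.
have ep : epi (q M \om idm \one).
  apply: (right_exact_epi (F := tensorr (am_mon C) \one)).
    exact: (hre \one).2.
  exact: ind_q_epi.
apply: ep; rewrite /= runit_nat -compA tens_comp comp_idl comp_idr.
have -> : q M \om alg_unit B =
    (q M \om idm B) \oc (idm (M \ox B) \om alg_unit B).
  by rewrite tens_comp comp_idl comp_idr.
rewrite compA ind_actE -!compA -(tensorm_id (am_mon C) M B) assoc_nat.
by rewrite [in LHS](compA (_ \om _)) -tens_compr alg_mul1r runit_tensor.
Qed.

Lemma ind_map_balanced (M N : rmodule A) (h : rmod_hom M N) :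
  let k := q N \oc (rmod_homm h \om idm B) in
  k \oc tensor_over_l M BA = k \oc tensor_over_r M BA.
Proof.
have e := (tensor_over_qP N BA).1; rewrite -/(q N) in e.
rewrite /= -!compA {1}/tensor_over_l /= -tens_compl rmod_hom_act tens_compl.
rewrite -[ract N \om _]/(tensor_over_l N BA).
rewrite compA e -!compA; congr (_ \oc _).
rewrite /tensor_over_r assoc_nat tensorm_id.
by rewrite !compA !tens_comp !comp_idl !comp_idr.
Qed.

Definition ind_hom (M N : rmodule A) (h : rmod_hom M N) : hom (T M) (T N) :=
  coeq_lift (tensor_over_qP M BA) (ind_map_balanced h).

Lemma ind_homE (M N : rmodule A) (h : rmod_hom M N) :
  ind_hom h \oc q M = q N \oc (rmod_homm h \om idm B).
Proof. exact: coeq_liftE. Qed.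

Program Definition ind_map (M N : rmodule A) (h : rmod_hom M N) :
  rmod_hom (ind_obj M) (ind_obj N) := {| rmod_homm := ind_hom h |}.
Next Obligation.
move=> M N h; apply: (coequalizer_epi (ind_qBP M)).
rewrite /= -!compA ind_actE -tens_compl ind_homE tens_compl !compA ind_homE ind_actE.
rewrite -!compA; congr (_ \oc _).
by rewrite assoc_nat tensorm_id !compA !tens_comp !comp_idl !comp_idr.
Qed.

Program Definition induction : functor (rmod_cat A) (rmod_cat B) :=
  {| fobj := ind_obj : rmod_cat A -> rmod_cat B; fmap := ind_map |}.
Next Obligation.
move=> M; apply: rmod_hom_inj; apply: ind_q_epi.
by rewrite ind_homE /= tensorm_id comp_idl comp_idr.
Qed.
Next Obligation.
move=> M N P g f; apply: rmod_hom_inj; apply: ind_q_epi.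
by rewrite ind_homE /= -compA ind_homE compA ind_homE -compA -tens_compl.
Qed.

End Induction.

Record image_factorization (C : category) (X Y : C) (f : hom X Y) :=
  ImageFactorization {
  im_obj : C;
  im_epi : hom X im_obj;
  im_mono : hom im_obj Y;
  im_epiP : epi im_epi;
  im_monoP : mono im_mono;
  im_fact : f = im_mono \oc im_epi }.

Section ImageAlgebra.
Variables (C : abelian_monoidal) (hre : right_exact_tensor C).
Variables (R S : algebra C) (f : alg_hom R S).
Variable I : image_factorization f.

Let psi : hom R (im_obj I) := im_epi I.
Let phi : hom (im_obj I) S := im_mono I.

(* im_mono I is a kernel and im_epi I (x) im_epi I is epi, so the
   multiplication of S restricts to the image. *)
Lemma im_mul_unique_ex : exists! m : hom (im_obj I \ox im_obj I) (im_obj I),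
  phi \oc m = alg_mul S \oc (phi \om phi).
Proof.
have fE : alg_homm f = phi \oc psi := im_fact I.
have [Z [c [cphi ker]]] := abelian_mono (am_abelian C) (@im_monoP _ _ _ _ I).
apply: ker; rewrite -/phi in cphi *.
have e1 : epi (idm R \om psi).
  apply: (right_exact_epi (F := tensorl (am_mon C) R)); first exact: (hre _).1.
  exact: im_epiP.
have e2 : epi (psi \om idm (im_obj I)).
  apply: (right_exact_epi (F := tensorr (am_mon C) (im_obj I))).
    exact: (hre _).2.
  exact: im_epiP.
apply: e2; apply: e1; rewrite !comp_0l.
rewrite -!compA !tens_comp !comp_idl !comp_idr -fE -alg_hom_mul fE.
by rewrite !compA cphi !comp_0l.
Qed.

Definition im_mul : hom (im_obj I \ox im_obj I) (im_obj I) :=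
  projT1 (cid im_mul_unique_ex).

Lemma im_mulE : phi \oc im_mul = alg_mul S \oc (phi \om phi).
Proof. exact: (projT2 (cid im_mul_unique_ex)).1. Qed.

Program Definition im_algebra : algebra C :=
  {| alg_obj := im_obj I; alg_mul := im_mul; alg_unit := psi \oc alg_unit R |}.
Next Obligation.
apply: (@im_monoP _ _ _ _ I); rewrite -/phi !compA im_mulE -!compA.
rewrite tens_comp im_mulE comp_idr (compA (phi \om phi)) tens_comp im_mulE.
rewrite comp_idr.
have -> : (alg_mul S \oc (phi \om phi)) \om phi =
    (alg_mul S \om idm S) \oc ((phi \om phi) \om phi).
  by rewrite tens_comp comp_idl.
have -> : phi \om (alg_mul S \oc (phi \om phi)) =
    (idm S \om alg_mul S) \oc (phi \om (phi \om phi)).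
  by rewrite tens_comp comp_idl.
by rewrite compA alg_mulA -!compA assoc_nat.
Qed.
Next Obligation.
apply: (@im_monoP _ _ _ _ I); rewrite -/phi compA im_mulE -compA.
rewrite tens_comp compA -(im_fact I) alg_hom_unit comp_idr -lunit_nat.
by rewrite -(alg_mul1l S) -compA tens_comp comp_idl comp_idr.
Qed.
Next Obligation.
apply: (@im_monoP _ _ _ _ I); rewrite -/phi compA im_mulE -compA.
rewrite tens_comp compA -(im_fact I) alg_hom_unit comp_idr -runit_nat.
by rewrite -(alg_mul1r S) -compA tens_comp comp_idl comp_idr.
Qed.

Program Definition im_psi : alg_hom R im_algebra := {| alg_homm := psi |}.
Next Obligation.
apply: (@im_monoP _ _ _ _ I); rewrite -/phi !compA im_mulE -(im_fact I).
by rewrite alg_hom_mul -compA tens_comp -(im_fact I).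
Qed.
Next Obligation. by []. Qed.

Program Definition im_phi : alg_hom im_algebra S := {| alg_homm := phi |}.
Next Obligation. exact: im_mulE. Qed.
Next Obligation. by rewrite compA -(im_fact I) alg_hom_unit. Qed.

End ImageAlgebra.

(* Main.v *)
(* Semiseparability of the induction along f gives, since 1 is a left tensor
   generator, an R-bimodule morphism E : S -> R with f E f = f. Writing
   f = phi psi and cancelling the mono phi and the epi psi, we get
   psi E phi = id. Hence E phi is a bimodule section of psi, which makes the
   induction along psi naturally full, and psi E is a bimodule retraction of
   phi (bilinear over Im(f) because psi (x) id and id (x) psi are epi), which
   makes the induction along phi separable. In both cases the required map
   sends g : M (x)_A B -> N (x)_A B to the composite
   M -> M (x)_A B -> N (x)_A B -> N, whose last arrow is induced by the
   bimodule morphism B -> A. *)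
From mathcomp Require Import all_boot boolp.
Require Import Defs.

Set Implicit Arguments.
Unset Strict Implicit.
Unset Printing Implicit Defensive.

(** * Coherence of the unit constraints and of their inverses *)

Section MonoidalCategory.
Variable C : abelian_monoidal.

Lemma iso_tensr (X Y Z : C) (f : hom X Y) : iso f -> iso (f \om idm Z).
Proof.
case=> g [gf fg]; exists (g \om idm Z).
by rewrite -!tens_compl gf fg !tensorm_id.
Qed.

Lemma tens_lr (X X' Y Y' : C) (f : hom X X') (g : hom Y Y') :
  f \om g = (f \om idm Y') \oc (idm X \om g).
Proof. by rewrite tens_comp comp_idl comp_idr. Qed.

Lemma tens_rl (X X' Y Y' : C) (f : hom X X') (g : hom Y Y') :
  f \om g = (idm X' \om g) \oc (f \om idm Y).
Proof. by rewrite tens_comp comp_idl comp_idr. Qed.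

(** Kelly's argument: tensoring with [\one] on the left is faithful because [lunt] is a natural
    isomorphism, and after tensoring the identity follows from pentagon and triangle. *)
Lemma lunit_tensor (X Y : C) :
  lunt (X \ox Y) \oc assc \one X Y = lunt X \om idm Y.
Proof.
suff e : idm \one \om (lunt (X \ox Y) \oc assc \one X Y) =
         idm \one \om (lunt X \om idm Y).
  apply: (iso_epi (lunit_iso (am_mon C) _)).
  by rewrite -!lunit_nat e.
apply: (iso_epi (assoc_iso (am_mon C) _ _ _)).
apply: (iso_epi (iso_tensr Y (assoc_iso (am_mon C) _ _ _))).
rewrite -assoc_nat tens_compr -!compA -tens_compl triangle.
by rewrite (compA (idm _ \om assc _ _ _)) -pentagon compA triangle
  -(tensorm_id (am_mon C) X Y) assoc_nat.
Qed.

Definition linv (X : C) : hom X (\one \ox X) :=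
  projT1 (cid (lunit_iso (am_mon C) X)).

Definition rinv (X : C) : hom X (X \ox \one) :=
  projT1 (cid (runit_iso (am_mon C) X)).

Lemma linvK (X : C) : linv X \oc lunt X = idm _.
Proof. exact: (projT2 (cid (lunit_iso (am_mon C) X))).1. Qed.

Lemma lunitK (X : C) : lunt X \oc linv X = idm _.
Proof. exact: (projT2 (cid (lunit_iso (am_mon C) X))).2. Qed.

Lemma rinvK (X : C) : rinv X \oc runt X = idm _.
Proof. exact: (projT2 (cid (runit_iso (am_mon C) X))).1. Qed.

Lemma runitK (X : C) : runt X \oc rinv X = idm _.
Proof. exact: (projT2 (cid (runit_iso (am_mon C) X))).2. Qed.

Lemma linv_nat (X Y : C) (f : hom X Y) :
  linv Y \oc f = (idm \one \om f) \oc linv X.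
Proof.
apply: (iso_mono (lunit_iso (am_mon C) Y)).
by rewrite !compA lunit_nat lunitK comp_idl -compA lunitK comp_idr.
Qed.

Lemma rinv_nat (X Y : C) (f : hom X Y) :
  rinv Y \oc f = (f \om idm \one) \oc rinv X.
Proof.
apply: (iso_mono (runit_iso (am_mon C) Y)).
by rewrite !compA runit_nat runitK comp_idl -compA runitK comp_idr.
Qed.

Lemma linv_tensor (X Y : C) :
  linv (X \ox Y) = assc \one X Y \oc (linv X \om idm Y).
Proof.
apply: (iso_mono (lunit_iso (am_mon C) _)).
by rewrite lunitK compA lunit_tensor -tens_compl lunitK tensorm_id.
Qed.

Lemma rinv_tensor (X Y : C) :
  assc X Y \one \oc rinv (X \ox Y) = idm X \om rinv Y.
Proof.
have e : mono (idm X \om runt Y).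
  apply: iso_mono; exists (idm X \om rinv Y).
  by rewrite -!tens_compr rinvK runitK !tensorm_id.
by apply: e; rewrite compA runit_tensor runitK -tens_compr runitK tensorm_id.
Qed.

End MonoidalCategory.

(** * The unit [m -> m (x) 1] of induction along [theta] *)

Section InductionTheory.
Variables (C : abelian_monoidal) (hre : right_exact_tensor C).
Variables (A B : algebra C) (theta : alg_hom A B).

Local Notation q M := (tensor_over_q M (alg_lmod theta)).
Local Notation T M := (tensor_over M (alg_lmod theta)).

Lemma tensor_over_q_balanced (M : rmodule A) :
  q M \oc (ract M \om idm B) =
  q M \oc (idm M \om (alg_mul B \oc (theta \om idm B))) \oc assc M A B.
Proof. by have := (tensor_over_qP M (alg_lmod theta)).1; rewrite compA. Qed.

(* Locked, here and below, because [compA] would otherwise match the composite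
   inside the unfolded definition. *)
Definition ind_unit (M : rmodule A) : hom M (T M) :=
  locked (q M \oc (idm M \om alg_unit B) \oc rinv M).

Lemma ind_unitE (M : rmodule A) :
  ind_unit M \oc runt M = q M \oc (idm M \om alg_unit B).
Proof. by rewrite /ind_unit -!lock -compA rinvK comp_idr. Qed.

(** Balancing: [m a (x) 1 = m (x) theta(a) 1 = m (x) theta(a)]. *)
Lemma ind_unit_act (M : rmodule A) :
  ind_unit M \oc ract M = q M \oc (idm M \om theta).
Proof.
rewrite /ind_unit -!lock -!compA rinv_nat (compA (idm M \om _)) -tens_rl.
rewrite tens_lr !compA tensor_over_q_balanced.
rewrite -(tensorm_id (am_mon C) M A) -!compA (compA (assc _ _ _)).
rewrite assoc_nat -compA rinv_tensor.
rewrite -!tens_compr -!compA (compA (theta \om _)) -tens_lr (tens_rl theta).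
by rewrite !compA alg_mul1r runit_nat -compA runitK comp_idr.
Qed.

(** In elements, [(m (x) 1) b = m (x) b]: the unit generates the induced module over [B]. *)
Lemma ind_act_unit (M : rmodule A) :
  ind_act hre theta M \oc (ind_unit M \om idm B) = q M.
Proof.
rewrite /ind_unit -!lock !tens_compl !compA ind_actE.
rewrite -!compA (compA (assc _ _ _)) assoc_nat !compA -(compA (q M)).
rewrite -tens_compr alg_mul1l -(compA (q M)) triangle -compA.
by rewrite -tens_compl runitK tensorm_id comp_idr.
Qed.

Lemma ind_unit_linear (M : rmodule A) :
  ind_unit M \oc ract M = ind_act hre theta M \oc (ind_unit M \om theta).
Proof. by rewrite tens_lr compA ind_act_unit ind_unit_act. Qed.

Lemma ind_unit_nat (M N : rmodule A) (h : rmod_hom M N) :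
  ind_hom theta h \oc ind_unit M = ind_unit N \oc h.
Proof.
rewrite /ind_unit -!lock !compA ind_homE -!compA rinv_nat.
by rewrite (compA (_ \om idm B)) -tens_lr (compA (idm N \om _)) -tens_rl.
Qed.

(** Uniqueness half of the adjunction with restriction: a [B]-linear map is determined by its values
    on [m (x) 1], which generate. *)
Lemma ind_hom_ext (M : rmodule A) (N : rmodule B)
    (g h : rmod_hom (ind_obj hre theta M) N) :
  g \oc ind_unit M = h \oc ind_unit M -> g = h.
Proof.
move=> e; apply: rmod_hom_inj; apply: ind_q_epi.
rewrite -ind_act_unit !compA.
have := rmod_hom_act g; have := rmod_hom_act h; rewrite /= => -> ->.
by rewrite -!compA -!tens_compl e.
Qed.

Definition bimodule_hom (E : hom B A) :=
  E \oc (alg_mul B \oc (theta \om idm B)) = alg_mul A \oc (idm A \om E) /\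
  E \oc (alg_mul B \oc (idm B \om theta)) = alg_mul A \oc (E \om idm A).

(** * Descending morphisms of induced modules by means of a bimodule morphism *)

Section BimoduleHom.
Variables (E : hom B A) (hE : bimodule_hom E).

(** Left linearity of [E] makes [n (x) b -> n E(b)] well defined on the tensor product over [A]. *)
Lemma ind_counit_balanced (N : rmodule A) :
  let k := ract N \oc (idm N \om E) in
  k \oc tensor_over_l N (alg_lmod theta) =
  k \oc tensor_over_r N (alg_lmod theta).
Proof.
rewrite /= /tensor_over_l /tensor_over_r /=.
rewrite -!compA (compA (idm N \om E)) -tens_compr hE.1.
rewrite -tens_rl tens_lr compA ractA tens_compr.
by rewrite -(tensorm_id (am_mon C) N A) -!compA assoc_nat !compA.
Qed.

Definition ind_counit (N : rmodule A) : hom (T N) N :=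
  coeq_lift (tensor_over_qP N (alg_lmod theta)) (ind_counit_balanced N).

Lemma ind_counitE (N : rmodule A) :
  ind_counit N \oc q N = ract N \oc (idm N \om E).
Proof. exact: coeq_liftE. Qed.

(** Comes from right linearity of [E]: [n E(b theta(a)) = n E(b) a]. *)
Lemma ind_counit_linear (N : rmodule A) :
  ind_counit N \oc ind_act hre theta N \oc (idm _ \om theta) =
  ract N \oc (ind_counit N \om idm A).
Proof.
have ep : epi (q N \om idm A).
  apply: (right_exact_epi (F := tensorr (am_mon C) A)); first exact: (hre A).2.
  exact: ind_q_epi.
apply: ep; rewrite /= -[RHS]compA -[in RHS]tens_compl ind_counitE tens_compl.
rewrite [RHS]compA ractA -!compA -tens_rl tens_lr (compA (ind_act _ _ _)).
rewrite ind_actE !compA ind_counitE -!compA -(tensorm_id (am_mon C) N B).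
rewrite !assoc_nat (compA (idm N \om alg_mul B)) -tens_compr.
rewrite (compA (idm N \om E)) -tens_compr hE.2.
by rewrite tens_compr -!compA.
Qed.

Lemma ind_counit_nat (M N : rmodule A) (h : rmod_hom M N) :
  ind_counit N \oc ind_hom theta h = h \oc ind_counit M.
Proof.
apply: ind_q_epi; rewrite -!compA ind_homE compA ind_counitE ind_counitE.
by rewrite -compA -tens_rl tens_lr !compA rmod_hom_act.
Qed.

(** All three factors are [A]-linear once [B]-modules are restricted along [theta]. *)
Lemma ind_descent_linear (M N : rmodule A)
    (g : rmod_hom (ind_obj hre theta M) (ind_obj hre theta N)) :
  ind_counit N \oc g \oc ind_unit M \oc ract M =
  ract N \oc ((ind_counit N \oc g \oc ind_unit M) \om idm A).
Proof.
rewrite -(compA _ (ind_unit M)) ind_unit_linear !compA -(compA _ g).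
have := rmod_hom_act g; rewrite /= => ->.
rewrite -!compA tens_comp comp_idl tens_rl.
rewrite (compA (ind_act _ _ _)) compA (compA (ind_counit N)) ind_counit_linear.
by rewrite -[LHS]compA -tens_compl.
Qed.

Definition ind_descent (M N : rmod_cat A)
    (g : hom (induction hre theta M) (induction hre theta N)) : hom M N :=
  RModHom (ind_descent_linear g).

Lemma ind_descent_natural : natural_family ind_descent.
Proof.
move=> X X' Y Y' h k g; apply: rmod_hom_inj => /=.
by rewrite !compA ind_counit_nat -!compA ind_unit_nat.
Qed.

Lemma bimodule_retraction_separable :
  E \oc theta = idm A -> separable (induction hre theta).
Proof.
move=> Et; exists ind_descent; split; first exact: ind_descent_natural.
move=> X Y h; apply: rmod_hom_inj => /=.
rewrite ind_counit_nat -compA.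
(* This composite sends [m] to [m E(1) = m E(theta(1)) = m]. *)
suff -> : ind_counit X \oc ind_unit X = idm _ by rewrite comp_idr.
apply: (iso_epi (runit_iso (am_mon C) X)).
rewrite -compA ind_unitE compA ind_counitE -compA -tens_compr.
by rewrite -(alg_hom_unit theta) compA Et comp_idl ract1 comp_idl.
Qed.

Lemma bimodule_section_naturally_full :
  theta \oc E = idm B -> naturally_full (induction hre theta).
Proof.
move=> tE; exists ind_descent; split; first exact: ind_descent_natural.
move=> X Y g; apply: ind_hom_ext; rewrite /= ind_unit_nat /= !compA.
(* This composite sends [m (x) b] to [m E(b) (x) 1 = m (x) theta(E(b)) = m (x) b]. *)
suff -> : ind_unit Y \oc ind_counit Y = idm _ by rewrite comp_idl.
apply: ind_q_epi; rewrite -compA ind_counitE compA ind_unit_act.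
by rewrite -compA -tens_compr tE tensorm_id comp_idl comp_idr.
Qed.

End BimoduleHom.

End InductionTheory.

Arguments bimodule_hom {C A B} theta E.

(** * Extracting a bimodule morphism from semiseparability *)

Section RegularModule.
Variables (C : abelian_monoidal) (hre : right_exact_tensor C).
Variables (A B : algebra C) (theta : alg_hom A B).

Local Notation q M := (tensor_over_q M (alg_lmod theta)).
Local Notation T M := (tensor_over M (alg_lmod theta)).
Local Notation lact := (alg_mul B \oc (theta \om idm B)).

Definition regular : rmodule A :=
  {| rmod_obj := alg_obj A; ract := alg_mul A;
     ractA := alg_mulA A; ract1 := alg_mul1r A |}.

Program Definition restricted : rmodule A :=
  {| rmod_obj := alg_obj B; ract := alg_mul B \oc (idm B \om theta) |}.
Next Obligation.
rewrite -compA -tens_rl tens_lr tens_compl.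
rewrite -(compA (alg_mul B \om _)) -tens_lr compA alg_mulA -compA assoc_nat.
rewrite -!compA (compA (idm B \om theta)) -tens_compr alg_hom_mul.
by rewrite tens_compr -compA.
Qed.
Next Obligation.
by rewrite -compA -tens_compr alg_hom_unit alg_mul1r.
Qed.

(* The isomorphism [B = A (x)_A B]. *)
Definition tensor_regular : hom B (T regular) :=
  locked (q regular \oc (alg_unit A \om idm B) \oc linv B).

(** Balancing again: [1 (x) theta(a) b = a (x) b]. *)
Lemma tensor_regular_act : tensor_regular \oc lact = q regular.
Proof.
rewrite /tensor_regular -!lock -!(compA (q regular)).
rewrite -(compA (alg_unit A \om _)) linv_nat.
rewrite (compA (alg_unit A \om _)) -tens_lr (tens_rl (alg_unit A)).
rewrite linv_tensor -!compA (compA (_ \om idm (A \ox B))).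
rewrite -(tensorm_id (am_mon C) A B) -assoc_nat !compA.
rewrite -(tensor_over_q_balanced theta regular) -!compA -!tens_compl /=.
by rewrite compA alg_mul1l lunitK tensorm_id comp_idr.
Qed.

Lemma lact_tensor_regular_balanced :
  lact \oc tensor_over_l regular (alg_lmod theta) =
  lact \oc tensor_over_r regular (alg_lmod theta).
Proof. by rewrite /tensor_over_l (lactA (alg_lmod theta)) -compA. Qed.

(** Through [a (x) b -> theta(a) b] the hypothesis becomes [theta(h(a)) b = theta(a) b]; then take
    [b = 1]. *)
Lemma ind_map_regular_inj (h : rmod_hom regular regular) :
  ind_hom theta h = idm _ -> theta \oc h = theta.
Proof.
move=> e.
pose l := coeq_lift (tensor_over_qP _ _) lact_tensor_regular_balanced.
have lE : l \oc q regular = lact by apply: coeq_liftE.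
have e1 : lact \oc (h \om idm B) = lact.
  by rewrite -lE -compA -(ind_homE theta h) e comp_idl.
have e2 (k : hom A A) : lact \oc (k \om idm B) \oc (idm A \om alg_unit B) =
    theta \oc k \oc runt A.
  rewrite -!compA -tens_lr (tens_comp theta) comp_idl tens_rl compA alg_mul1r.
  by rewrite runit_nat !compA.
apply: (iso_epi (runit_iso (am_mon C) A)).
by rewrite -e2 e1; have := e2 (idm A); rewrite tensorm_id !comp_idr.
Qed.

(** Left multiplication by the global element [e]. *)
Definition lmul (X : algebra C) (e : hom \one X) : hom X X :=
  locked (alg_mul X \oc (e \om idm X) \oc linv X).

Lemma lmulE (X : algebra C) (e : hom \one X) :
  lmul e \oc lunt X = alg_mul X \oc (e \om idm X).
Proof. by rewrite /lmul -!lock -compA linvK comp_idr. Qed.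

(** Associativity makes left multiplications right linear, so they are endomorphisms of [regular]
    and [restricted] against which naturality can be tested. *)
Lemma lmul_mul (X : algebra C) (e : hom \one X) :
  lmul e \oc alg_mul X = alg_mul X \oc (lmul e \om idm X).
Proof.
rewrite /lmul -!lock -!compA linv_nat (compA (e \om _)) -tens_lr tens_rl.
rewrite linv_tensor !tens_compl !compA alg_mulA -!compA.
by rewrite -(tensorm_id (am_mon C) X X) (compA (assc _ _ _)) assoc_nat !compA.
Qed.

Definition regular_lmul (e : hom \one A) : rmod_hom regular regular :=
  @RModHom C A regular regular (lmul e) (lmul_mul e).

Lemma restricted_lmul_linear (e : hom \one B) :
  lmul e \oc ract restricted = ract restricted \oc (lmul e \om idm A).
Proof. by rewrite /= compA lmul_mul -!compA -tens_lr -tens_rl. Qed.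

Definition restricted_lmul (e : hom \one B) : rmod_hom restricted restricted :=
  @RModHom C A restricted restricted (lmul e) (restricted_lmul_linear e).

Lemma lmul_theta (e : hom \one A) :
  lmul (theta \oc e) \oc lact = lact \oc (lmul e \om idm B).
Proof.
rewrite compA lmul_mul -!compA -!tens_compl.
congr (_ \oc (_ \om _)).
rewrite /lmul -!lock -!compA linv_nat (compA (_ \om idm B)) -tens_lr.
rewrite (compA theta) alg_hom_mul -compA (compA (theta \om theta)).
by rewrite tens_comp comp_idr.
Qed.

(** Acting by the unit of [A] already gives the isomorphism [lunt B]. *)
Lemma lact_epi : epi lact.
Proof.
move=> Z g h e; have e1 : lact \oc (alg_unit A \om idm B) = lunt B.
  by rewrite -compA -tens_compl alg_hom_unit alg_mul1l.
apply: (iso_epi (lunit_iso (am_mon C) B)).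
by rewrite -e1 !(compA _ lact) e.
Qed.

Lemma tensor_regular_lmul (e : hom \one A) :
  tensor_regular \oc lmul (theta \oc e) =
  ind_hom theta (regular_lmul e) \oc tensor_regular.
Proof.
apply: lact_epi; rewrite -!compA lmul_theta tensor_regular_act.
rewrite (ind_homE theta (regular_lmul e)).
by rewrite /= compA tensor_regular_act.
Qed.

Lemma tensor_regular_linear :
  tensor_regular \oc alg_mul B =
  ind_act hre theta regular \oc (tensor_regular \om idm B).
Proof.
rewrite /tensor_regular -!lock !tens_compl !compA ind_actE.
rewrite -!compA linv_nat (compA (_ \om idm B)) -tens_lr tens_rl.
rewrite (compA (assc _ _ _)) assoc_nat tensorm_id linv_tensor.
by rewrite -!compA.
Qed.

Lemma mul_restricted_balanced :
  alg_mul B \oc tensor_over_l restricted (alg_lmod theta) =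
  alg_mul B \oc tensor_over_r restricted (alg_lmod theta).
Proof.
rewrite /tensor_over_l /tensor_over_r /=.
rewrite tens_compl compA alg_mulA -!compA assoc_nat.
by rewrite (compA (_ \om alg_mul B)) -tens_compr.
Qed.

Definition counit_restricted : hom (T restricted) B :=
  coeq_lift (tensor_over_qP _ _) mul_restricted_balanced.

Lemma counit_restrictedE : counit_restricted \oc q restricted = alg_mul B.
Proof. exact: coeq_liftE. Qed.

(** The adjunction counit [b (x) b' -> b b'] at [B], with target rewritten as [A (x)_A B]: being a
    morphism between induced modules, it is a possible argument of the family [P]. *)
Program Definition counit_regular :
  rmod_hom (ind_obj hre theta restricted) (ind_obj hre theta regular) :=
  {| rmod_homm := tensor_regular \oc counit_restricted |}.
Next Obligation.
apply: (coequalizer_epi (ind_qBP hre theta restricted)).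
rewrite /= -!compA (ind_actE hre theta restricted) !compA.
rewrite -(compA tensor_regular) counit_restrictedE.
rewrite -[RHS]compA -[in RHS]tens_compl -[in RHS]compA counit_restrictedE.
rewrite tens_compl [RHS]compA -tensor_regular_linear.
by rewrite -!compA alg_mulA -!compA.
Qed.

Lemma alg_hom_restricted_linear :
  theta \oc ract regular = ract restricted \oc (theta \om idm A).
Proof. by rewrite /= -compA -tens_rl alg_hom_mul. Qed.

Definition alg_hom_restricted : rmod_hom regular restricted :=
  @RModHom C A regular restricted theta alg_hom_restricted_linear.

Local Notation F := (induction hre theta).
Local Notation eps := (counit_regular : hom (F restricted) (F regular)).

(** Both sides send [b (x) b'] to [1 (x) theta(e) b b']. *)
Lemma counit_regular_lmul (e : hom \one A) :
  fmap F (regular_lmul e : hom (regular : rmod_cat A) regular) \oc eps =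
  eps \oc fmap F (restricted_lmul (theta \oc e) :
    hom (restricted : rmod_cat A) restricted).
Proof.
apply: rmod_hom_inj; apply: ind_q_epi => /=.
rewrite compA -tensor_regular_lmul -!compA.
rewrite (ind_homE theta (restricted_lmul (theta \oc e))) /=.
by rewrite (compA counit_restricted) counit_restrictedE lmul_mul.
Qed.

(** A triangle identity: [a (x) b -> theta(a) b -> 1 (x) theta(a) b = a (x) b]. *)
Lemma counit_regular_alg_hom :
  eps \oc fmap F (alg_hom_restricted : hom (regular : rmod_cat A) restricted) =
  idm (F regular).
Proof.
apply: rmod_hom_inj; apply: ind_q_epi => /=.
rewrite -!compA (ind_homE theta alg_hom_restricted) /=.
rewrite (compA counit_restricted) counit_restrictedE.
by rewrite tensor_regular_act comp_idl.
Qed.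

(* [E] is the component at [A] of the natural map [M (x)_A B -> M] given by
   semiseparability. Naturality against left multiplications by [e : 1 -> A],
   which are the only ones available, gives left linearity because [1] is a
   left tensor generator. *)
Lemma semiseparable_bimodule_hom :
  left_tensor_generator (munit (am_mon C)) ->
  semiseparable (induction hre theta) ->
  exists2 E : hom B A, bimodule_hom theta E & theta \oc E \oc theta = theta.
Proof.
move=> gen [P [Pnat PK]].
pose E : rmod_hom restricted regular := P restricted regular counit_regular.
(* By naturality of [P], the two sides are its values at the two sides of [counit_regular_lmul]. *)
have EK (e : hom \one A) : E \oc lmul (theta \oc e) = lmul e \oc E.
  have := Pnat restricted restricted regular regular
    (restricted_lmul (theta \oc e)) (idm _) counit_regular.
  have := Pnat restricted restricted regular regular
    (idm _) (regular_lmul e) counit_regular.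
  rewrite !fmap_id !comp_idl !comp_idr counit_regular_lmul => -> e1.
  exact: esym (congr1 (@rmod_homm _ _ _ _) e1).
exists E; first split.
- apply: gen => e.
  rewrite -!compA -!tens_compl -lmulE -tens_rl tens_lr.
  by rewrite [RHS]compA -lmulE -[RHS]compA lunit_nat !compA EK.
- by rewrite (rmod_hom_act E).
(* Naturality gives [E \oc theta = P(id)] by the triangle identity, and semiseparability at the
   identity says that induction sends [P(id)] to the identity. *)
- rewrite -compA.
  apply: (ind_map_regular_inj (h := rmod_comp E alg_hom_restricted)).
  have := Pnat restricted regular regular regular
    alg_hom_restricted (idm _) counit_regular.
  rewrite fmap_id !comp_idl counit_regular_alg_hom => e1.
  have := PK regular regular (idm _); rewrite fmap_id e1.
  by move=> /(congr1 (@rmod_homm _ _ _ _)).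
Qed.

End RegularModule.

(** * Transfer of the bimodule morphism to the two factors of the image *)

Section Image.
Variables (C : abelian_monoidal) (hre : right_exact_tensor C).
Variables (R S : algebra C) (f : alg_hom R S) (I : image_factorization f).
Variables (E : hom S R) (hE : bimodule_hom f E).

(** Since [phi] is multiplicative, [E(phi(psi(r) x)) = E(f(r) phi(x)) = r E(phi(x))], and
    symmetrically on the right. *)
Lemma im_psi_bimodule_hom : bimodule_hom (im_psi hre I) (E \oc im_mono I).
Proof.
have fE : alg_homm f = im_mono I \oc im_epi I := im_fact I.
split=> /=.
- rewrite -compA (compA (im_mono I)) im_mulE -!compA tens_comp -fE comp_idr.
  by rewrite tens_lr !compA -(compA E) hE.1 tens_compr compA.
- rewrite -compA (compA (im_mono I)) im_mulE -!compA tens_comp -fE comp_idr.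
  by rewrite tens_rl !compA -(compA E) hE.2 tens_compl compA.
Qed.

(** On scalars [psi(r)] it reads [psi(E(f(r) s)) = psi(r E(s)) = psi(r) psi(E(s))]; right exactness
    keeps [psi] epi after tensoring, so such scalars suffice. *)
Lemma im_phi_bimodule_hom : bimodule_hom (im_phi hre I) (im_epi I \oc E).
Proof.
have fE : alg_homm f = im_mono I \oc im_epi I := im_fact I.
have psiM := alg_hom_mul (im_psi hre I); rewrite /= in psiM.
split=> /=.
- have ep : epi (im_epi I \om idm S).
    apply: (right_exact_epi (F := tensorr (am_mon C) S)).
      exact: (hre _).2.
    exact: im_epiP.
  apply: ep; rewrite -!compA -tens_compl -fE hE.1 compA psiM -!compA -tens_rl.
  by rewrite tens_comp comp_idr.
- have ep : epi (idm S \om im_epi I).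
    apply: (right_exact_epi (F := tensorl (am_mon C) S)).
      exact: (hre _).1.
    exact: im_epiP.
  apply: ep; rewrite -!compA -tens_compr -fE hE.2 compA psiM -!compA -tens_lr.
  by rewrite tens_comp comp_idr.
Qed.

Lemma im_retraction :
  f \oc E \oc f = f -> im_epi I \oc E \oc im_mono I = idm (im_obj I).
Proof.
move=> e; apply: (@im_epiP _ _ _ _ I); apply: (@im_monoP _ _ _ _ I).
by rewrite comp_idl -(im_fact I) -[RHS]e [in RHS](im_fact I) !compA.
Qed.

End Image.

Theorem corollary3p14 (C : abelian_monoidal) (hre : right_exact_tensor C)
    (hgen : left_tensor_generator (munit (am_mon C)))
    (R S : algebra C) (f : alg_hom R S)
    (hf : semiseparable (induction hre f))
    (I : image_factorization f) :
  naturally_full (induction hre (im_psi hre I)) /\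
  separable (induction hre (im_phi hre I)).
Proof.
have [E hE /(im_retraction I) EK] := semiseparable_bimodule_hom hgen hf.
(* The single equation [psi E phi = id] is bracketed as [psi (E phi)] for the section and as
   [(psi E) phi] for the retraction. *)
split.
- apply: (bimodule_section_naturally_full hre (im_psi_bimodule_hom hre I hE)).
  by rewrite /= compA.
- exact: (bimodule_retraction_separable hre (im_phi_bimodule_hom hre I hE)).
Qed.
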